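(* There is a universal constant $\kappa>0$ such that the following holds. Let $n,m\in\mathbb{N}$, let $k$ be a positive odd integer with $k<m/2$, let $q,A,S\ge1$, and for $j\in\{1,\dots,n\}$ let $\mathcal{E}_jf(x)$ denote the average of $f(x+y)$ over $y\in S(j,k)$. Suppose that there exist probability measures $\beta_1,\beta_2$ on $E_\infty(\mathbb{Z}_m^n)$ such that for every Banach space $(X,\|\cdot\|_X)$ and every $f:\mathbb{Z}_m^n\to X$ both of the inequalities $$\frac1n\sum_{j=1}^n\int_{\mathbb{Z}_m^n}\|\mathcal{E}_jf(x)-f(x)\|_X^q\,d\mu(x)\le A^q\int_{E_\infty(\mathbb{Z}_m^n)}\|f(x)-f(y)\|_X^q\,d\beta_1(x,y)$$ and $$\int_{\mathbb{Z}_m^n}\int_{\{-1,1\}^n}\Big\|\sum_{j=1}^n\varepsilon_j\big(\mathcal{E}_jf(x+e_j)-\mathcal{E}_jf(x-e_j)\big)\Big\|_X^q\,d\tau(\varepsilon)\,d\mu(x)\le S^q\int_{E_\infty(\mathbb{Z}_m^n)}\|f(x)-f(y)\|_X^q\,d\beta_2(x,y)$$ hold. Then $$A\ge\kappa k\qquad\text{and}\qquad S\ge\kappa\min\left\{\sqrt{\frac nk},\ \frac nk\right\}.$$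
   Context: $\mathbb{Z}_m=\mathbb{Z}/m\mathbb{Z}$, $[n]=\{1,\dots,n\}$, and $e_1,\dots,e_n$ is the standard basis of $\mathbb{Z}_m^n$. $\mu$ is the uniform probability measure on $\mathbb{Z}_m^n$ and $\tau$ is the uniform probability measure on $\{-1,1\}^n$. $$E_\infty(\mathbb{Z}_m^n)=\{(x,y)\in\mathbb{Z}_m^n\times\mathbb{Z}_m^n:\ x-y\in\{-1,0,1\}^n\}.$$ For an odd integer $k<m/2$ the integer box $[-k,k]^n$ is identified with a subset of $\mathbb{Z}_m^n$, and for $j\in[n]$, $$S(j,k)=\{y\in[-k,k]^n\subseteq\mathbb{Z}_m^n:\ y_j\text{ is even and } y_\ell\text{ is odd for all }\ell\in[n]\setminus\{j\}\},$$ $$\mathcal{E}_jf(x)=\frac1{\mu(S(j,k))}\int_{S(j,k)}f(x+y)\,d\mu(y).$$ *)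

(* Defs.v *)
From HB Require Import structures.
From mathcomp Require Import all_boot all_order all_algebra.
From mathcomp Require Import all_classical all_reals all_analysis.
Import Order.TTheory GRing.Theory Num.Theory.
Import numFieldNormedType.Exports.
Set Implicit Arguments.
Unset Strict Implicit.
Unset Printing Implicit Defensive.
Local Open Scope classical_set_scope.
Local Open Scope ring_scope.

(* 'Z_m is Z/mZ only for m > 1; below, m is larger than twice a positive k. *)
Definition torus (m n : nat) := 'rV['Z_m]_n.

Definition stdbasis (m n : nat) (j : 'I_n) : torus m n := delta_mx 0 j.

Definition E_infty (m n : nat) : {set torus m n * torus m n} :=
  [set p | [forall i, (p.1 - p.2 : torus m n) 0 i \in [:: -1; 0; 1]]].

(* E_infty as a type, equipped with the sigma-algebra of all its subsets. *)
Definition edge (m n : nat) : Type :=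
  {p : torus m n * torus m n | p \in E_infty m n}.

HB.instance Definition _ (m n : nat) := Finite.on (edge m n).

Lemma E_infty0 (m n : nat) : ((0, 0) : torus m n * torus m n) \in E_infty m n.
Proof. by rewrite inE; apply/forallP => i; rewrite /= subrr mxE !inE eqxx orbT. Qed.

HB.instance Definition _ (m n : nat) :=
  isPointed.Build (edge m n) (Sub (0, 0) (E_infty0 m n)).

HB.instance Definition _ (m n : nat) :=
  @isMeasurable.Build default_measure_display (edge m n) discrete_measurable
    discrete_measurable0 (@discrete_measurableC _) (@discrete_measurableU _).

(* S(j, k): the image in the torus of the integer points of [-k, k]^n whose
   j-th coordinate is even and whose other coordinates are all odd; the
   reduction mod m is injective on [-k, k]^n when 2k < m. *)
Definition S_set (m n k : nat) (j : 'I_n) : {set torus m n} :=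
  [set y : torus m n | `[< exists z : 'rV[int]_n,
     [/\ y = map_mx intr z :> torus m n,
         forall i, - k%:Z <= z 0 i <= k%:Z,
         ~~ odd (absz (z 0 j)) &
         forall l, l != j -> odd (absz (z 0 l))] >]]%SET.

(* Integral against the uniform probability measure on a finite type. *)
Definition unif_int (R : realType) (T : finType) (F : T -> R) : R :=
  (#|T|%:R)^-1 * \sum_(t : T) F t.

Section Operators.
Variables (R : realType) (m n : nat) (X : completeNormedModType R).

(* The factor 1 / mu(S(j, k)) and the weights of the uniform measure mu
   combine into the plain average over S(j, k). *)
Definition smooth (k : nat) (j : 'I_n) (f : torus m n -> X) (x : torus m n) : X :=
  (#|S_set m k j|%:R)^-1 *: \sum_(y in S_set m k j) f (x + y).

Definition approx_lhs (k : nat) (q : R) (f : torus m n -> X) : R :=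
  (n%:R)^-1 * \sum_(j < n)
    unif_int (fun x : torus m n => `|smooth k j f x - f x| `^ q).

(* A sign vector is encoded by booleans b, with epsilon_j = (-1) ^ b_j. *)
Definition smooth_lhs (k : nat) (q : R) (f : torus m n -> X) : R :=
  unif_int (fun x : torus m n =>
    unif_int (fun b : {ffun 'I_n -> bool} =>
      `| \sum_(j < n) (-1) ^+ (b j) *:
           (smooth k j f (x + stdbasis m j) - smooth k j f (x - stdbasis m j)) |
      `^ q)).

Definition edge_int (q : R) (beta : probability (edge m n) R)
    (f : torus m n -> X) : \bar R :=
  (\int[beta]_(p in setT) (`|f (val p).1 - f (val p).2| `^ q)%:E)%E.

End Operators.

(* Main.v *)
Require Import Defs.
From HB Require Import structures.
From mathcomp Require Import all_boot all_order all_algebra.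
From mathcomp Require Import all_classical all_reals all_analysis.
From mathcomp Require Import complex ring lra zify.
Import Order.TTheory GRing.Theory Num.Theory.
Import numFieldNormedType.Exports.
Import ComplexField.Normc.

(** Both bounds come from testing the hypothesis on one function with values
    in a finite-dimensional sup-norm space.  Such a function is a finite family
    of scalar functions F t.  If every F t varies by at most D along the edges,
    then whatever the probability measure on the edges, the right-hand side is
    at most (A D)^q, resp. (S D)^q ([le_of_edge_int]).  The norm on the left
    dominates every coordinate, so the member of the family may be chosen
    separately for each point x and each sign vector, which yields a lower
    bound V^q as soon as, for each choice, one coordinate is at least V.
    Hence V <= A D, resp. V <= S D.

    For A, the family is F t w = the circular distance from w_0 to t_0 in Z/m,
    which is 1-Lipschitz.  At x the coordinate t = x vanishes, and its smoothing
    is the average of |y_0| over S(j, k), that is, over the odd or over the even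
    points of [-k, k].  This is of order k when k >= 3; when k = 1 the bound
    follows from A >= 1.

    For S, shifting S(j, k) by e_j or by -e_j makes every coordinate odd, and
    the sum over the j-th coordinate of f(x + y + e_j) - f(x + y - e_j)
    telescopes, leaving only the faces y_j = k and y_j = -k.  Fix
    u = c + i s on the unit circle and, for signs eps, let
    P(w) = prod_l u^(eps_l ([w_l = k] - [w_l = -k])), with u^-1 the conjugate
    of u.  The function Im P is bounded by 1, so it varies by at most 2 along
    edges, and since S(j, k) is a product set, averages of P factor over the
    coordinates.  The j-th one contributes eps_j 2 i s / k and each other one
    the real number omega = 1 - 2 (1 - c) / (k + 1); both facts hold for either
    sign.  Summing over j with the signs eps_j gives exactly
    V = (2 n s / k) omega^(n-1) ([smooth_phase_jump]).  With r = n / k and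
    s = min(1, 1 / sqrt r) / 2, Bernoulli's inequality keeps omega^(n-1)
    above 1/2, so V >= r s = min(sqrt r, r) / 2 ([phase_sum_ge],
    [exists_phase]). *)

Set Implicit Arguments.
Unset Strict Implicit.
Unset Printing Implicit Defensive.
Local Open Scope ring_scope.

(** * Sup-norm valued families of scalar functions *)

(** Joins the maximum norm and the entrywise completeness of real matrices into
    one Banach space structure. *)
HB.instance Definition _ (R : realType) (n p : nat) := Complete.on 'M[R]_(n, p).

Section SupNorm.
Variables (R : realType) (N : nat).

Lemma coord_le_norm (v : 'rV[R]_N) (i : 'I_N) : `|v 0 i| <= `|v|.
Proof.
rewrite [leRHS]/Num.norm /= mx_normrE.
by apply/bigmax_geP; right => /=; exists (0, i).
Qed.

Lemma norm_le_coord (v : 'rV[R]_N) (D : R) :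
  0 <= D -> (forall i, `|v 0 i| <= D) -> `|v| <= D.
Proof.
move=> D0 vD; rewrite [leLHS]/Num.norm /= mx_normrE.
by apply/bigmax_leP; split=> // -[a i] _ /=; rewrite (ord1 a).
Qed.

End SupNorm.

Section SupFamily.
Variables (R : realType) (m n : nat) (T : finType).
Variable F : T -> torus m n -> R.

(** The l_infinity sum of the family, the index set being enumerated so that
    the values are row vectors, which carry the maximum norm. *)
Definition sup_family (w : torus m n) : 'rV[R]_#|T| :=
  \row_i F (enum_val i) w.

Lemma sup_familyE w t : sup_family w 0 (enum_rank t) = F t w.
Proof. by rewrite mxE enum_rankK. Qed.

(** Coordinates are linear, so smoothing acts coordinatewise. *)
Lemma smooth_sup_family k j w t :
  smooth k j sup_family w 0 (enum_rank t) =
  (#|S_set m k j|%:R)^-1 * \sum_(y in S_set m k j) F t (w + y).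
Proof.
rewrite /smooth mxE summxE; congr (_ * _); apply: eq_bigr => y _.
exact: sup_familyE.
Qed.

Lemma sup_family_edge (D : R) : 0 <= D ->
  (forall t (p : edge m n), `|F t (val p).1 - F t (val p).2| <= D) ->
  forall p : edge m n, `|sup_family (val p).1 - sup_family (val p).2| <= D.
Proof.
move=> D0 FD p; apply: norm_le_coord => // i.
by rewrite !mxE; exact: FD.
Qed.

End SupFamily.

(** * Integral estimates *)

Section Bounds.
Variables (R : realType).

Lemma le_unif_int (T : finType) (t0 : T) (F : T -> R) (a : R) :
  (forall t, a <= F t) -> a <= unif_int F.
Proof.
move=> aF; have T0 : (0 < #|T|)%N by apply/card_gt0P; exists t0.
rewrite /unif_int mulrC ler_pdivlMr ?ltr0n // mulr_natr -sumr_const.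
by apply: ler_sum.
Qed.

Lemma edge_int_le (m n : nat) (q D : R) (beta : probability (edge m n) R)
    (X : completeNormedModType R) (f : torus m n -> X) : 0 <= q -> 0 <= D ->
  (forall p : edge m n, `|f (val p).1 - f (val p).2| <= D) ->
  (edge_int q beta f <= (D `^ q)%:E)%E.
Proof.
move=> q0 D0 fD; rewrite /edge_int.
apply: (@le_trans _ _ (\int[beta]_(p in setT) (cst (D `^ q)%:E p))%E).
  apply: ge0_le_integral => //.
  by move=> p _; rewrite lee_fin ge0_ler_powR // ?nnegrE.
by rewrite integral_cst // [X in (_ * X)%E](@probability_setT _ _ _ beta) mule1.
Qed.

(** The edge measure is arbitrary, so the only information on the right-hand
    side that survives is a uniform bound D on the edge differences; taking
    q-th roots then compares V with C D. *)
Lemma le_of_edge_int (m n : nat) (q D V C L : R) (beta : probability (edge m n) R)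
    (X : completeNormedModType R) (f : torus m n -> X) :
  0 < q -> 0 <= D -> 0 <= V -> 0 <= C ->
  (forall p : edge m n, `|f (val p).1 - f (val p).2| <= D) ->
  V `^ q <= L -> (L%:E <= (C `^ q)%:E * edge_int q beta f)%E -> V <= C * D.
Proof.
move=> q0 D0 V0 C0 fD VL LC.
have : ((V `^ q)%:E <= (C `^ q)%:E * (D `^ q)%:E)%E.
  apply: le_trans (le_trans LC _); first by rewrite lee_fin.
  apply: lee_wpmul2l; first by rewrite lee_fin powR_ge0.
  exact: edge_int_le (ltW q0) D0 fD.
rewrite -EFinM lee_fin -powRM // => VCD.
rewrite leNgt; apply/negP => CDV.
have := gt0_ltr_powR q0 _ _ CDV.
by rewrite !nnegrE mulr_ge0 // V0 ltNge VCD => /(_ isT isT).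
Qed.

Lemma bernoulli (x : R) N : x <= 1 -> 1 - N%:R * x <= (1 - x) ^+ N.
Proof.
move=> x1; elim: N => [|N IH]; first by rewrite mul0r subr0.
rewrite exprS; apply: (@le_trans _ _ ((1 - x) * (1 - N%:R * x))).
  rewrite -natr1; have : 0 <= N%:R * x ^+ 2 by rewrite mulr_ge0 ?sqr_ge0.
  lra.
by rewrite ler_wpM2l // subr_ge0.
Qed.

End Bounds.

(** * Residues of small integers and the circular distance *)

Section Residues.
Variable m : nat.
Hypothesis m1 : (1 < m)%N.

Lemma intr_Zp_eq0 (z : int) : (`|z| < m)%N -> (z%:~R == 0 :> 'Z_m) = (z == 0).
Proof.
have natE (i : nat) : (i < m)%N -> (i%:R == 0 :> 'Z_m) = (i == 0)%N.
  by move=> im; rewrite -val_eqE /= val_Zp_nat // modn_small.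
case: (intP z) => [|i|i] // zm; first by rewrite natE.
by rewrite mulrNz !oppr_eq0 natE.
Qed.

Definition circ_norm (a : 'Z_m) : nat := minn a (m - a).

Lemma circ_norm_intr (z : int) : (2 * `|z| < m)%N ->
  circ_norm z%:~R = `|z|%N.
Proof.
rewrite /circ_norm.
case: (intP z) => [|i|i] zm; first by rewrite /= min0n.
  rewrite val_Zp_nat //; rewrite modn_small; lia.
have -> : (- i.+1%:Z)%:~R = (m - i.+1)%N%:R :> 'Z_m.
  rewrite natrB; last lia.
  by rewrite pchar_Zp // sub0r mulrNz.
rewrite val_Zp_nat // modn_small; lia.
Qed.

(** The only case that is not immediate is the wrap-around a = m - 1. *)
Lemma circ_norm_lip1 (a : 'Z_m) :
  (circ_norm (a + 1)%R <= (circ_norm a).+1)%N /\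
  (circ_norm a <= (circ_norm (a + 1)%R).+1)%N.
Proof.
have E : nat_of_ord (a + 1)%R = (a.+1 %% m)%N.
  have -> : a + 1 = (a.+1)%:R :> 'Z_m by rewrite -natr1 natr_Zp.
  by rewrite val_Zp_nat.
have am : (a < m)%N by have := ltn_ord a; rewrite [X in (_ < X)%N]Zp_cast.
rewrite /circ_norm E.
have [am1|am1] := ltnP a.+1 m; first by rewrite modn_small //; lia.
have -> : a.+1 = m by lia.
rewrite modnn; lia.
Qed.

Lemma circ_norm_lip (a b : 'Z_m) : a - b \in [:: -1; 0; 1] ->
  (circ_norm a <= (circ_norm b).+1)%N /\ (circ_norm b <= (circ_norm a).+1)%N.
Proof.
rewrite !inE => /or3P[] /eqP/(canRL (subrK _)) ->.
- by have := circ_norm_lip1 (-1 + b); rewrite addrC addNKr // addrC => -[].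
- by rewrite add0r; split.
- by rewrite addrC; have [] := circ_norm_lip1 b.
Qed.

End Residues.

(** * S(j, k) as a product of arithmetic progressions *)

(** The N points of step 2 centred at 0: for k odd, N = k gives the even
    integers of [-k, k] and N = k + 1 gives the odd ones. *)
Definition rung (N i : nat) : int := (2 * i)%:Z - (N.-1)%:Z.

Lemma rung_bound N i : (i < N)%N -> (`|rung N i| <= N.-1)%N.
Proof. rewrite /rung; lia. Qed.

Definition side (n k : nat) (j l : 'I_n) : nat := if l == j then k else k.+1.

Section ProductStructure.
Variables (m n k : nat).
Hypotheses (k_odd : odd k) (km : (2 * k < m)%N).

Let m1 : (1 < m)%N. Proof. lia. Qed.

(** Differences of two rungs are at most 2k in absolute value, so reduction
    modulo m > 2k identifies none of them; this is what makes sums over residues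
    into sums over indices. *)
Lemma rung_inj N : (N <= k.+1)%N ->
  {in [pred i | (i < N)%N] &, injective (fun i => (rung N i)%:~R : 'Z_m)}.
Proof.
move=> Nk i i'; rewrite !inE => iN i'N /eqP.
rewrite -subr_eq0 -rmorphB /= intr_Zp_eq0 //; rewrite /rung; lia.
Qed.

Lemma mem_S_set (j : 'I_n) (y : torus m n) :
  (y \in S_set m k j) =
  [forall l, [exists i : 'I_(side k j l), y 0 l == (rung (side k j l) i)%:~R]].
Proof.
rewrite inE; apply/asboolP/forallP => [[z [-> zk zj zl]] l|yP].
  (* The index of the integer z in the progression is (z + N - 1) / 2. *)
  have := zk l; rewrite /side; case: eqP => [->|/eqP lj] zlk.
    have ik : (`|(z 0%R j + (k.-1)%:Z)%R|./2 < k)%N by move: zj; lia.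
    apply/existsP; exists (Ordinal ik); rewrite mxE /rung /=; apply/eqP.
    congr (_%:~R); move: zj; lia.
  have := zl l lj => {}zl.
  have ik : (`|(z 0%R l + k%:Z)%R|./2 < k.+1)%N by lia.
  apply/existsP; exists (Ordinal ik); rewrite mxE /rung /=; apply/eqP.
  congr (_%:~R); lia.
have /fin_all_exists[i iP] (l : 'I_n) : exists i : 'I_(side k j l),
    y 0 l = (rung (side k j l) i)%:~R.
  by have /existsP[i /eqP yi] := yP l; exists i.
have sk l : (i l < side k j l)%N by exact: ltn_ord.
exists (\row_l rung (side k j l) (i l)); split.
- by apply/rowP => l; rewrite !mxE iP.
- move=> l; rewrite mxE; have := sk l; move: (nat_of_ord (i l)) => v.
  by rewrite /rung /side; case: (l == j); lia.
- rewrite mxE; have := sk j; move: (nat_of_ord (i j)) => v.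
  by rewrite /rung /side eqxx; lia.
- move=> l /negPf lj; rewrite mxE; have := sk l.
  by move: (nat_of_ord (i l)) => v; rewrite /rung /side lj; lia.
Qed.

(** Membership in S(j, k) is a condition on each coordinate separately, so
    expanding the product of sums produces the sum over S(j, k). *)
Lemma sum_S_set (K : comPzRingType) (j : 'I_n) (G : 'I_n -> 'Z_m -> K) :
  \sum_(y in S_set m k j) \prod_l G l (y 0 l) =
  \prod_l \sum_(i < side k j l) G l (rung (side k j l) i)%:~R.
Proof.
pose Q l (a : 'Z_m) := [exists i : 'I_(side k j l), a == (rung (side k j l) i)%:~R].
transitivity (\prod_l \sum_(a | Q l a) G l a); last first.
  apply: eq_bigr => l _.
  pose f (i : 'I_(side k j l)) : 'Z_m := (rung (side k j l) i)%:~R.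
  have finj : injective f.
    move=> i i' /rung_inj ii'; apply: val_inj; apply: ii'; rewrite ?inE ?ltn_ord //.
    by rewrite /side; case: ifP.
  have <- : \sum_(i in [set: 'I_(side k j l)]) G l (f i) = \sum_i G l (f i).
    by apply: eq_bigl => i; rewrite inE.
  rewrite -(big_imset _ (in2W finj)) /=.
  apply: eq_bigl => a; apply/existsP/imsetP => [[i /eqP ->]|[i _ ->]].
    by exists i; rewrite ?inE.
  by exists i; rewrite eqxx.
rewrite bigA_distr_big_dep.
rewrite (reindex (fun f : {ffun 'I_n -> 'Z_m} => \row_l f l : torus m n)) /=; last first.
  exists (fun y : torus m n => [ffun l => y 0 l]) => [f _|y _].
    by apply/ffunP => l; rewrite ffunE mxE.
  by apply/rowP => l; rewrite mxE ffunE.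
apply: eq_big => [f|f _]; last by apply: eq_bigr => l _; rewrite mxE.
rewrite mem_S_set; apply/forallP/familyP => yP l; first by have := yP l; rewrite mxE.
by have := yP l; rewrite mxE.
Qed.

(** Taking all G l = 1 in the previous factorization computes the cardinal of
    S(j, k), so the normalization factors as well. *)
Lemma avg_S_set (K : fieldType) (j : 'I_n) (G : 'I_n -> 'Z_m -> K) :
  (#|S_set m k j|%:R)^-1 * \sum_(y in S_set m k j) \prod_l G l (y 0 l) =
  \prod_l ((side k j l)%:R^-1 *
           \sum_(i < side k j l) G l (rung (side k j l) i)%:~R).
Proof.
have -> : #|S_set m k j|%:R = \prod_l (side k j l)%:R :> K.
  transitivity (\sum_(y in S_set m k j) \prod_(l < n) (1 : K)).
    by rewrite big1_eq sumr_const.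
  rewrite (sum_S_set j (fun _ _ => 1)).
  by apply: eq_bigr => l _; rewrite sumr_const card_ord.
by rewrite sum_S_set -prodfV -big_split.
Qed.

End ProductStructure.

Lemma sum_sqr_rung (R : realType) N :
  \sum_(i < N.+1) (`|rung N.+1 i|%N%:R : R) ^+ 2 =
  N%:R * (N.+1)%:R * (N.+2)%:R / 3.
Proof.
have H c M : \sum_(i < M) ((2 * i%:R - c : R) ^+ 2) =
    M%:R * (c ^+ 2 - 2 * c * (M%:R - 1)) + 2 / 3 * M%:R * (M%:R - 1) * (2 * M%:R - 1).
  elim: M => [|M IH]; first by rewrite big_ord0; ring.
  by rewrite big_ord_recr /= IH -natr1; field.
transitivity (\sum_(i < N.+1) ((2 * i%:R - N%:R : R) ^+ 2)); last first.
  by rewrite H -!natr1; field.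
apply: eq_bigr => i _.
have -> : `|rung N.+1 i|%N%:R = `|(rung N.+1 i)%:~R| :> R by rewrite -intr_norm -abszE.
by rewrite real_normK ?num_real // /rung mulrzBr -!pmulrn natrM.
Qed.

(** On [-k, k] one has |z| >= z^2 / k, which replaces the sum of absolute
    values, whose closed form depends on the parity of N, by the sum of squares,
    whose closed form does not.  The average obtained is (N^2 - 1) / (3 k), and
    k >= 3 gives (k^2 - 1) / (3 k) >= k / 4. *)
Lemma avg_rung_ge (R : realType) k N : (3 <= k)%N -> (k <= N <= k.+1)%N ->
  4^-1 * k%:R <= (N%:R)^-1 * \sum_(i < N) (`|rung N i|%N%:R : R).
Proof.
move=> k3; case: N => [|N] /andP[kN Nk]; first lia.
have k0 : 0 < k%:R :> R by rewrite ltr0n; lia.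
have sqle : (k%:R)^-1 * \sum_(i < N.+1) (`|rung N.+1 i|%N%:R : R) ^+ 2 <=
    \sum_(i < N.+1) (`|rung N.+1 i|%N%:R : R).
  rewrite mulr_sumr; apply: ler_sum => i _.
  rewrite mulrC ler_pdivrMr // expr2 ler_wpM2l // ler_nat.
  have := rung_bound (ltn_ord i); lia.
apply: le_trans (ler_wpM2l _ sqle); last by rewrite invr_ge0.
rewrite sum_sqr_rung.
have -> : N.+1%:R^-1 * (k%:R^-1 * (N%:R * N.+1%:R * N.+2%:R / 3)) =
    (N%:R * N.+2%:R / 3) / k%:R :> R.
  by field; rewrite gt_eqF //= pnatr_eq0.
rewrite ler_pdivlMr //.
have : (3 * k * k <= 4 * (N * N.+2))%N by nia.
rewrite -(ler_nat R) !natrM; lra.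
Qed.

(** * The lower bound on A *)

Lemma edge_coord (m n : nat) (p : edge m n) (l : 'I_n) :
  (val p).1 0 l - (val p).2 0 l \in [:: -1; 0; 1 : 'Z_m].
Proof.
by have := valP p; rewrite inE => /forallP /(_ l); rewrite !mxE.
Qed.

Section Approximation.
Variables (R : realType) (m n : nat) (l0 : 'I_n).

(** Kuratowski's embedding of the circle Z/m, along the coordinate l0. *)
Definition frechet (t w : torus m n) : R := (circ_norm ((w - t) 0 l0))%:R.

Lemma frechet_edge t (p : edge m n) : (1 < m)%N ->
  `|frechet t (val p).1 - frechet t (val p).2| <= 1.
Proof.
move=> m1; have := edge_coord p l0; rewrite /frechet; move: (val p) => [x y] /= xy.
have /circ_norm_lip[//|] : (x - t) 0 l0 - (y - t) 0 l0 \in [:: -1; 0; 1 : 'Z_m].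
  by rewrite !mxE opprB addrA subrK.
rewrite -!(ler_nat R) -!natr1 ler_norml; lra.
Qed.

Variable k : nat.
Hypotheses (k_odd : odd k) (km : (2 * k < m)%N).

(** A function of the single coordinate l0 is a product of functions of the
    coordinates, all but one of which are 1.  The estimate holds whether j = l0
    (even values) or not (odd values), which covers n = 1. *)
Lemma avg_circ_norm_ge (j : 'I_n) : (3 <= k)%N ->
  4^-1 * k%:R <= (#|S_set m k j|%:R)^-1 *
    \sum_(y in S_set m k j) (circ_norm (y 0 l0))%:R :> R.
Proof.
move=> k3.
pose G l (a : 'Z_m) : R := if l == l0 then (circ_norm a)%:R else 1.
under eq_bigr => y _.
  have -> : (circ_norm (y 0 l0))%:R = \prod_l G l (y 0 l).
    rewrite (bigD1 l0) //= /G eqxx big1 ?mulr1 // => l /negPf ->//.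
  over.
have free l : l != l0 -> (side k j l)%:R^-1 *
    \sum_(i < side k j l) G l (rung (side k j l) i)%:~R = 1.
  move=> /negPf ll0; rewrite /G ll0 sumr_const card_ord mulVf // pnatr_eq0 /side.
  by case: (l == j); lia.
rewrite /= avg_S_set // (bigD1 l0) //= (big1 _ _ _ free) mulr1.
apply: le_trans (avg_rung_ge R k3 (N := side k j l0) _) _.
  by rewrite /side; case: eqP => _; lia.
rewrite ler_wpM2l ?invr_ge0 //; apply: ler_sum => i _.
rewrite /G eqxx circ_norm_intr //; first lia.
have := rung_bound (ltn_ord i); move: (nat_of_ord i) => v.
rewrite /side; case: eqP => _; lia.
Qed.

(** At the point x, the coordinate indexed by x itself is used. *)
Lemma approx_lhs_ge (q : R) : (3 <= k)%N -> 0 <= q ->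
  (4^-1 * k%:R) `^ q <= approx_lhs k q (sup_family frechet).
Proof.
move=> k3 q0.
have main j (x : torus m n) :
    4^-1 * k%:R <= `|smooth k j (sup_family frechet) x - sup_family frechet x|.
  apply: le_trans (coord_le_norm _ (enum_rank x)).
  rewrite mxE [(- sup_family _ _) _ _]mxE smooth_sup_family sup_familyE.
  have -> : frechet x x = 0.
    by rewrite /frechet subrr mxE /circ_norm /= min0n.
  rewrite subr0 (le_trans (avg_circ_norm_ge j k3)) //.
  apply: le_trans (ler_norm _); rewrite ler_wpM2l ?invr_ge0 //.
  by apply: ler_sum => y _; rewrite /frechet addrAC subrr add0r.
have n0 : (0 < n)%N by case: (n) l0 => [[]|].
rewrite /approx_lhs [leRHS]mulrC ler_pdivlMr ?ltr0n //.
set V := (X in X * _ <= _); have -> : V * n%:R = \sum_(j < n) V.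
  by rewrite sumr_const card_ord mulr_natr.
apply: ler_sum => j _; apply: (le_unif_int (0 : torus m n)) => x.
by rewrite ge0_ler_powR // ?nnegrE // mulr_ge0.
Qed.

End Approximation.

(** * The smoothing expression of a product of phases *)

Section Smoothing.
Variables (R : realType) (m n k : nat).
Hypotheses (k_odd : odd k) (km : (2 * k < m)%N).
Variables (c s : R).
Hypothesis cs1 : c ^+ 2 + s ^+ 2 = 1.

Let m1 : (1 < m)%N. Proof. lia. Qed.

(** With u = c + i s, this is u^eps at a = k, u^-eps at a = -k and 1
    elsewhere, where eps = (-1)^b. *)
Definition end_phase (b : bool) (a : 'Z_m) : R[i] :=
  if a == (k%:Z)%:~R then Complex c ((-1) ^+ b * s)
  else if a == (- k%:Z)%:~R then Complex c (- ((-1) ^+ b * s)) else 1.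

Definition phase_test (t : torus m n * {ffun 'I_n -> bool}) (w : torus m n) : R :=
  complex.Im (\prod_l end_phase (t.2 l) ((w - t.1) 0 l)).

Lemma normc_end_phase b a : normc (end_phase b a) = 1.
Proof.
have sqs : ((-1) ^+ b * s) ^+ 2 = s ^+ 2.
  by rewrite exprMn sqrr_sign mul1r.
rewrite /end_phase; case: ifP => _; last case: ifP => _; last exact: normc1.
  by rewrite /normc sqs cs1 sqrtr1.
by rewrite /normc sqrrN sqs cs1 sqrtr1.
Qed.

Lemma phase_test_le1 t w : `|phase_test t w| <= 1.
Proof.
have : normc (\prod_l end_phase (t.2 l) ((w - t.1) 0 l)) = 1.
  rewrite (big_morph _ (@normcM R) (@normc1 R)) big1 // => l _.
  exact: normc_end_phase.
rewrite /phase_test; case: (\prod_l _) => x y /= xy1.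
by rewrite -xy1 -sqrtr_sqr ler_wsqrtr // lerDr sqr_ge0.
Qed.

(** The average of [end_phase] over the odd points of [-k, k]: k - 1 of these
    k + 1 points contribute 1, and the two ends contribute 2 c together,
    whatever the sign. *)
Definition decay : R := 1 - 2 * (1 - c) / k.+1%:R.

Lemma end_phase_pos b : end_phase b (k%:Z)%:~R = Complex c ((-1) ^+ b * s).
Proof. by rewrite /end_phase eqxx. Qed.

Lemma end_phase_neg b :
  end_phase b (- k%:Z)%:~R = Complex c (- ((-1) ^+ b * s)).
Proof.
rewrite /end_phase eqxx ifN // -subr_eq0 -rmorphB /= intr_Zp_eq0 //; lia.
Qed.

Lemma end_phase_mid b (z : int) : (`|z| < k)%N -> end_phase b z%:~R = 1.
Proof.
move=> zk; rewrite /end_phase !ifN // -subr_eq0 -rmorphB /= intr_Zp_eq0 //; lia.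
Qed.

Lemma avg_end_phase b :
  k.+1%:R^-1 * \sum_(i < k.+1) end_phase b (rung k.+1 i)%:~R = (decay%:C)%C.
Proof.
have -> : \sum_(i < k.+1) end_phase b (rung k.+1 i)%:~R =
    ((k.+1%:R - 2 * (1 - c))%:C)%C.
  case: (k) k_odd km end_phase_pos end_phase_neg end_phase_mid
    => // k' _ _ epos eneg emid.
  rewrite big_ord_recl big_ord_recr /= (eq_bigr (fun=> 1)) => [|i _]; last first.
    by apply: emid; rewrite /rung /bump /=; have := ltn_ord i; lia.
  have -> : rung k'.+2 0 = - k'.+1%:Z by rewrite /rung; lia.
  have -> : rung k'.+2 (bump 0 k') = k'.+1%:Z by rewrite /rung /bump; lia.
  rewrite epos eneg sumr_const card_ord.
  have -> : k'%:R = (k'%:R)%:C%C :> R[i] by rewrite rmorph_nat.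
  by apply/eqP; rewrite eq_complex /= -!natr1; apply/andP; split; apply/eqP; ring.
have -> : k.+1%:R = (k.+1%:R)%:C%C :> R[i] by rewrite rmorph_nat.
rewrite -fmorphV -rmorphM /decay /=; congr (_%:C)%C.
by rewrite mulrBr mulVf ?pnatr_eq0 // mulrC.
Qed.

(** Moving the even points by +1 or by -1 gives consecutive odd points, so the
    sum telescopes to the difference between the two ends. *)
Lemma end_phase_jump b :
  \sum_(i < k) (end_phase b ((rung k i)%:~R + 1) - end_phase b ((rung k i)%:~R - 1))
  = Complex 0 (2 * ((-1) ^+ b * s)).
Proof.
have k0 : (0 < k)%N by case: (k) k_odd.
pose g i := end_phase b (rung k.+1 i)%:~R.
transitivity (\sum_(0 <= i < k) (g i.+1 - g i)).
  rewrite big_mkord; apply: eq_bigr => i _; rewrite /g -[1]/(1%:~R) -rmorphD -rmorphB /=.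
  by congr (end_phase _ _%:~R - end_phase _ _%:~R); rewrite /rung; lia.
rewrite telescope_sumr // /g.
have -> : rung k.+1 0 = - k%:Z by rewrite /rung; lia.
have -> : rung k.+1 k = k%:Z by rewrite /rung; lia.
rewrite end_phase_pos end_phase_neg; apply/eqP; rewrite eq_complex /=.
by rewrite subrr eqxx /= opprK mulr_natl mulr2n.
Qed.

(** A shift by d e_j only alters the j-th factor of the product; the other
    factors each average to the real number [decay], which therefore comes out
    of the imaginary part. *)
Lemma avg_phase_test x (b : {ffun 'I_n -> bool}) j d :
  (#|S_set m k j|%:R)^-1 *
    \sum_(y in S_set m k j) phase_test (x, b) (x + d *: stdbasis m j + y) =
  complex.Im (k%:R^-1 * \sum_(i < k) end_phase (b j) ((rung k i)%:~R + d)) *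
    decay ^+ n.-1.
Proof.
have ImD : {morph @complex.Im R : z w / z + w} by move=> [? ?] [? ?].
have ImZ (r : R) z : complex.Im (r%:C%C * z) = r * complex.Im z.
  by case: z => z1 z2 /=; rewrite mul0r addr0.
have natC N : (N%:R : R[i]) = (N%:R)%:C%C by rewrite rmorph_nat.
pose G l a := end_phase (b l) (a + (if l == j then d else 0)).
have FE y : phase_test (x, b) (x + d *: stdbasis m j + y) =
    complex.Im (\prod_l G l (y 0 l)).
  rewrite /phase_test /G; congr complex.Im; apply: eq_bigr => l _ /=.
  congr end_phase; rewrite !mxE eqxx /= addrAC [x 0 l + _]addrC addrK addrC.
  by case: (l == j); rewrite ?mulr1 ?mulr0.
rewrite (eq_bigr _ (fun y _ => FE y)) -(big_morph _ ImD (erefl : complex.Im 0 = 0)).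
have off l : l != j -> (side k j l)%:R^-1 *
    \sum_(i < side k j l) G l (rung (side k j l) i)%:~R = decay%:C%C.
  move=> /negPf lj; rewrite -(avg_end_phase (b l)) /side lj; congr (_ * _).
  by apply: eq_bigr => i _; rewrite /G lj addr0.
rewrite -ImZ fmorphV /= -natC avg_S_set // (bigD1 j) //= (eq_bigr _ off).
rewrite prodr_const cardC1 card_ord -rmorphXn /= mulrC ImZ mulrC.
by rewrite /G /side eqxx.
Qed.

(** The sign of the j-th jump matches the sign in front of it, so every j
    contributes the same positive amount. *)
Lemma smooth_phase_jump x (b : {ffun 'I_n -> bool}) j :
  (-1) ^+ b j * ((#|S_set m k j|%:R)^-1 *
      \sum_(y in S_set m k j) phase_test (x, b) (x + stdbasis m j + y) -
    (#|S_set m k j|%:R)^-1 *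
      \sum_(y in S_set m k j) phase_test (x, b) (x - stdbasis m j + y)) =
  2 * s / k%:R * decay ^+ n.-1.
Proof.
have ImB (z w : R[i]) : complex.Im (z - w) = complex.Im z - complex.Im w.
  by case: z w => [? ?] [? ?].
have := avg_phase_test x b j 1; rewrite scale1r => ->.
have := avg_phase_test x b j (-1); rewrite scaleN1r => ->.
rewrite -mulrBl -ImB -mulrBr -sumrB end_phase_jump.
have -> : k%:R^-1 = (k%:R^-1)%:C%C :> R[i] by rewrite fmorphV rmorph_nat.
rewrite /= mul0r addr0; move: (decay ^+ _) => D.
have := @sqrr_sign R (b j); move: ((-1) ^+ b j) => e e2.
by rewrite -[RHS]mul1r -e2; ring.
Qed.

Lemma smooth_lhs_ge (q : R) : 0 <= q -> 0 <= s -> 0 <= decay ->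
  (n%:R * (2 * s / k%:R * decay ^+ n.-1)) `^ q <=
    smooth_lhs k q (sup_family phase_test).
Proof.
move=> q0 s0 d0.
apply: (le_unif_int (0 : torus m n)) => x.
apply: (le_unif_int ([ffun=> false] : {ffun 'I_n -> bool})) => b.
rewrite ge0_ler_powR // ?nnegrE //.
  by rewrite !mulr_ge0 ?invr_ge0 ?exprn_ge0.
apply: le_trans (coord_le_norm _ (enum_rank (x, b))).
rewrite summxE; apply: le_trans (ler_norm _).
rewrite (eq_bigr (fun=> 2 * s / k%:R * decay ^+ n.-1)) => [|j _].
  by rewrite sumr_const card_ord mulr_natl.
have coordB (u v : 'rV[R]_#|{: torus m n * {ffun 'I_n -> bool}}|) i :
    (u - v) 0 i = u 0 i - v 0 i by rewrite !mxE.
rewrite mxE coordB !smooth_sup_family.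
exact: smooth_phase_jump.
Qed.

End Smoothing.

(** * Choice of the phase and conclusion *)

Section PhaseChoice.
Variables (R : realType) (n k : nat).
Hypotheses (n0 : (0 < n)%N) (k0 : (0 < k)%N).

Let r : R := n%:R / k%:R.

(** The witness is s = 1/2 when r <= 1 and s = 1 / (2 sqrt r) when r >= 1; the
    bound on r s^2 keeps the power of [decay] in [phase_sum_ge] above 1/2. *)
Lemma exists_phase : exists c s : R,
  [/\ c ^+ 2 + s ^+ 2 = 1, 0 <= s, 0 <= c, r * s ^+ 2 <= 4^-1 &
      Num.min (Num.sqrt r) r <= 2 * (r * s)].
Proof.
have r0 : 0 < r by rewrite divr_gt0 ?ltr0n.
have [s [s0 s4 rs2 rs]] : exists s : R, [/\ 0 <= s, s ^+ 2 <= 4^-1,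
    r * s ^+ 2 <= 4^-1 & Num.min (Num.sqrt r) r <= 2 * (r * s)].
  have [r1|r1] := leP r 1.
    exists 2^-1; split; rewrite ?expr2; try lra.
    by rewrite ge_min; apply/orP; right; lra.
  have t0 : 0 < Num.sqrt r by rewrite sqrtr_gt0.
  have t2 : Num.sqrt r ^+ 2 = r by rewrite sqr_sqrtr // ltW.
  exists (2^-1 * (Num.sqrt r)^-1); split.
  - by rewrite mulr_ge0 // invr_ge0 ltW.
  - rewrite exprMn !exprVn t2 -[leRHS]mulr1; apply: ler_pM => //; try lra.
      by rewrite invr_ge0 ltW.
    by rewrite invf_le1 // ltW.
  - rewrite exprMn !exprVn t2 mulrCA divff ?gt_eqF //; lra.
  - rewrite ge_min; apply/orP; left; rewrite -{2}t2.
    set t := Num.sqrt r in t0 *.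
    by rewrite [leRHS](_ : _ = t) //; field; rewrite gt_eqF.
exists (Num.sqrt (1 - s ^+ 2)), s; split=> //.
by rewrite sqr_sqrtr ?subrK // subr_ge0; lra.
Qed.

(** Since 1 - c <= s^2, the decay factor is 1 - x with
    (n - 1) x <= 2 r s^2 <= 1/2, and Bernoulli's inequality bounds its power
    below by 1/2. *)
Lemma phase_sum_ge (c s : R) : c ^+ 2 + s ^+ 2 = 1 -> 0 <= s -> 0 <= c ->
  r * s ^+ 2 <= 4^-1 ->
  0 <= decay k c /\ r * s <= n%:R * (2 * s / k%:R * decay k c ^+ n.-1).
Proof.
move=> cs1 s0 c0 rs.
have c1 : c <= 1 by have := sqr_ge0 s; nra.
have cs : 1 - c <= s ^+ 2 by nra.
have K0 : 0 < k.+1%:R :> R by rewrite ltr0n.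
pose x : R := 2 * (1 - c) / k.+1%:R.
have x1 : x <= 1.
  rewrite /x ler_pdivrMr // mul1r.
  have : 2%:R <= k.+1%:R :> R by rewrite ler_nat.
  lra.
have x0 : 0 <= x by rewrite /x; apply: divr_ge0; [lra | exact: ltW].
have nx : n.-1%:R * x <= 2^-1.
  apply: (@le_trans _ _ (2 * (r * s ^+ 2))); last lra.
  apply: (@le_trans _ _ (n%:R * (2 * s ^+ 2 / k%:R))).
    apply: ler_pM => //; first by rewrite ler_nat leq_pred.
    rewrite /x; apply: ler_pM; rewrite ?invr_ge0 ?mulr_ge0 ?subr_ge0 //.
      by rewrite ler_wpM2l.
    by rewrite lef_pV2 ?posrE ?ltr0n // ler_nat.
  by rewrite /r; lra.
have half : 2^-1 <= decay k c ^+ n.-1.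
  by apply: le_trans (bernoulli n.-1 x1); lra.
split; first by rewrite subr_ge0.
rewrite (_ : n%:R * _ = r * s * (2 * decay k c ^+ n.-1)); last by rewrite /r; ring.
rewrite -[leLHS]mulr1 ler_wpM2l //; last lra.
by rewrite mulr_ge0 // divr_ge0.
Qed.

End PhaseChoice.

Theorem proposition4p2 (R : realType) :
  exists kappa : R, 0 < kappa /\
    forall (n m k : nat) (q A S : R),
      (0 < n)%N -> odd k -> (2 * k < m)%N ->
      1 <= q -> 1 <= A -> 1 <= S ->
      (exists beta1 beta2 : probability (edge m n) R,
        forall (X : completeNormedModType R) (f : torus m n -> X),
          ((approx_lhs k q f)%:E <= (A `^ q)%:E * edge_int q beta1 f)%E /\
          ((smooth_lhs k q f)%:E <= (S `^ q)%:E * edge_int q beta2 f)%E) ->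
      kappa * k%:R <= A /\
      kappa * Num.min (Num.sqrt (n%:R / k%:R)) (n%:R / k%:R) <= S.
Proof.
exists 4^-1; split; first by rewrite invr_gt0.
move=> n m k q A S n0 k_odd km q1 A1 S1 [beta1 [beta2 ineqs]].
have k0 : (0 < k)%N by case: (k) k_odd.
have q_gt0 : 0 < q by lra.
have A0 : 0 <= A by lra.
have S0 : 0 <= S by lra.
split.
  (* k = 1 is covered by A >= 1, since the average over S(j, 1) may vanish. *)
  have [k2|k3] := leqP k 2.
    have : k%:R <= 2 :> R by rewrite ler_nat.
    lra.
  pose F := frechet R (m := m) (Ordinal n0).
  have [bound1 _] := ineqs _ (sup_family F).
  have V0 : 0 <= 4^-1 * k%:R :> R by rewrite mulr_ge0.
  rewrite -[A]mulr1; apply: (le_of_edge_int q_gt0 _ V0 A0 _ _ bound1) => //.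
    by apply: sup_family_edge => // t p; apply: frechet_edge; lia.
  by apply: approx_lhs_ge => //; exact: ltW.
have [c [s [cs1 s0 c0 rs2 rs]]] := exists_phase R n0 k0.
have [d0 Vge] := phase_sum_ge k0 cs1 s0 c0 rs2.
pose F := phase_test (m := m) (n := n) k c s.
have [_ bound2] := ineqs _ (sup_family F).
have V0 : 0 <= n%:R * (2 * s / k%:R * decay k c ^+ n.-1).
  by apply: le_trans Vge; rewrite mulr_ge0 // divr_ge0.
have : n%:R * (2 * s / k%:R * decay k c ^+ n.-1) <= S * 2.
  apply: (le_of_edge_int q_gt0 _ V0 S0 _ _ bound2) => //.
    apply: sup_family_edge => // t p; apply: le_trans (ler_normB _ _) _.
    by rewrite -[leRHS]/(1 + 1) lerD // phase_test_le1.
  by apply: smooth_lhs_ge => //; exact: ltW.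
lra.
Qed.
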